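(* Let $n\ge 1$ be an integer. Let $x_j^{(0)}=\cos\theta_j^{(0)}$ with $\theta_j^{(0)}=j\pi/n$, $j=0,\ldots,n$, be the Chebyshev--Lobatto points, and let $\Lambda_n^{(0)}$ be their Lebesgue constant. Let $x_j=\cos\theta_j$ with $\theta_j=\theta_j^{(0)}+\varepsilon_j$, $j=0,\ldots,n$, where $\varepsilon_j\in\mathbb{R}$ and $\varepsilon_0=\varepsilon_n=0$, be perturbed points, and assume that $x_0,\ldots,x_n$ are distinct. Let $\Lambda_n$ be the Lebesgue constant of $\{x_0,\ldots,x_n\}$. Suppose that $\sigma_n>0$ satisfies $$\max_{0\le j\le n}|\varepsilon_j|\le\sigma_n .$$ If $$n\sigma_n\Lambda_n^{(0)}<1,$$ then $$\Lambda_n\le\frac{\Lambda_n^{(0)}}{1-n\sigma_n\Lambda_n^{(0)}}.$$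
   Context: For a set of distinct nodes $\{x_0,\ldots,x_n\}\subset[-1,1]$, the Lagrange basis polynomials are $\ell_j(x)=\prod_{k\ne j}\frac{x-x_k}{x_j-x_k}$, $j=0,\ldots,n$, and the Lebesgue constant of the node set is $\max_{x\in[-1,1]}\sum_{j=0}^n|\ell_j(x)|$. *)

(* Defs.v *)
From HB Require Import structures.
From mathcomp Require Import all_boot all_order all_algebra.
From mathcomp Require Import all_classical all_reals all_analysis.

Set Implicit Arguments.
Unset Strict Implicit.
Unset Printing Implicit Defensive.

Import Order.TTheory GRing.Theory Num.Theory.
Import numFieldNormedType.Exports.

Local Open Scope classical_set_scope.
Local Open Scope ring_scope.

(* The lagrange basis of mathcomp.algebra.qpoly is not used: its theory asks
   for sampling points [x : nat -> R] that are injective on the whole of nat,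
   whereas the nodes below form a finite family. *)
Definition lagrange_basis (R : realType) (n : nat) (x : 'I_n.+1 -> R)
    (j : 'I_n.+1) : {poly R} :=
  \prod_(k < n.+1 | k != j) ((x j - x k)^-1 *: ('X - (x k)%:P)).

Definition lebesgue_function (R : realType) (n : nat) (x : 'I_n.+1 -> R)
    (t : R) : R :=
  \sum_(j < n.+1) `|(lagrange_basis x j).[t]|.

(* The supremum is a maximum, see [lebesgue_constant_max]. *)
Definition lebesgue_constant (R : realType) (n : nat) (x : 'I_n.+1 -> R) : R :=
  sup [set lebesgue_function x t | t in `[-1, 1]].

Definition lobatto_angle (R : realType) (n : nat) (j : 'I_n.+1) : R :=
  j%:R * pi / n%:R.

Definition lobatto_point (R : realType) (n : nat) (j : 'I_n.+1) : R :=
  cos (lobatto_angle R j).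

Lemma lagrange_basisE (R : realType) (n : nat) (x : 'I_n.+1 -> R) j t :
  (lagrange_basis x j).[t] =
  \prod_(k < n.+1 | k != j) ((t - x k) / (x j - x k)).
Proof.
rewrite /lagrange_basis horner_prod; apply: eq_bigr => k _.
by rewrite hornerZ hornerXsubC mulrC.
Qed.

Lemma continuous_lebesgue_function (R : realType) (n : nat)
    (x : 'I_n.+1 -> R) : continuous (lebesgue_function x).
Proof.
move=> t; apply: cvg_big => [|j _]; first exact: add_continuous.
by apply: cvg_norm; exact: continuous_horner.
Qed.

Lemma lebesgue_constant_max (R : realType) (n : nat) (x : 'I_n.+1 -> R) :
  (exists2 c, c \in `[-1, 1] & lebesgue_function x c = lebesgue_constant x) /\
  (forall t, t \in `[-1, 1] -> lebesgue_function x t <= lebesgue_constant x).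
Proof.
have [|c c11 cmax] := @EVT_max R (lebesgue_function x) (-1) 1 (ge0_cp ler01).2.
  by apply: continuous_subspaceT; exact: continuous_lebesgue_function.
suff E : lebesgue_function x c = lebesgue_constant x.
  by split; [exists c | move=> t t11; rewrite -E; exact: cmax].
have ub : ubound [set lebesgue_function x t | t in `[-1, 1]]
    (lebesgue_function x c) by move=> _ [t t11 <-]; exact: cmax.
have Lc : [set lebesgue_function x t | t in `[-1, 1]] (lebesgue_function x c).
  by exists c.
apply/eqP; rewrite eq_le; apply/andP; split.
  by apply: ub_le_sup => //; exists (lebesgue_function x c).
by apply: ge_sup => //; exists (lebesgue_function x c).
Qed.

(* Main.v *)
Require Import Defs.
From HB Require Import structures.
From mathcomp Require Import all_boot all_order all_algebra.
From mathcomp Require Import all_classical all_reals all_analysis.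
From mathcomp Require Import zify ring lra.
Import Order.TTheory GRing.Theory Num.Theory.
Import numFieldNormedType.Exports.
Local Open Scope ring_scope.

(* Let [p] be the interpolant at the perturbed nodes of the signs of the basis
   polynomials at a maximizer [c] of the Lebesgue function, so that
   [p(c) = Lambda_n = max |p|].  Bernstein's inequality applied to [p(cos t)]
   gives [|p(x_j^(0))| <= 1 + n sigma_n Lambda_n], and interpolating [p] at the
   Chebyshev-Lobatto points yields
   [Lambda_n <= (1 + n sigma_n Lambda_n) Lambda_n^(0)].
   Bernstein's inequality follows from M. Riesz's formula
   [T'(x) = sum_k w_k T(x + t_k)] with [sum_k |w_k| = n]. *)

(** * Trigonometric sums over the nodes of Riesz's formula *)

Lemma sin_natpi (R : realType) (k : nat) : sin (k%:R * pi) = 0 :> R.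
Proof.
elim: k => [|k IHk]; first by rewrite mul0r sin0.
by rewrite -natr1 mulrDl mul1r sinDpi IHk oppr0.
Qed.

Lemma cos_nat2pi (R : realType) (k : nat) : cos (k%:R * (pi *+ 2)) = 1 :> R.
Proof.
elim: k => [|k IHk]; first by rewrite mul0r cos0.
by rewrite -natr1 mulrDl mul1r cosD2pi.
Qed.

Lemma sin_nat2pi (R : realType) (k : nat) : sin (k%:R * (pi *+ 2)) = 0 :> R.
Proof. by rewrite mulr_natl -mulrnA -mulr_natl sin_natpi. Qed.

(** The terms telescope: 2 sin a cos((2k+1)a) = sin((2k+2)a) - sin(2ka). *)
Lemma sum_cos_odd_multiples (R : realType) (N : nat) (a : R) :
  2 * sin a * \sum_(k < N) cos ((k.*2.+1)%:R * a) = sin ((N.*2)%:R * a).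
Proof.
elim: N => [|N IHN]; first by rewrite big_ord0 mul0r sin0 mulr0.
rewrite big_ord_recr /= mulrDr IHN doubleS.
have E : N.*2.+1%:R * a = N.*2%:R * a + a by rewrite -natr1 mulrDl mul1r.
have -> : N.*2.+2%:R * a = N.*2.+1%:R * a + a by rewrite -[in LHS]natr1 mulrDl mul1r.
have -> : N.*2%:R * a = N.*2.+1%:R * a - a by rewrite E addrK.
by rewrite !sinD sinN cosN; ring.
Qed.

(** For k < 2n these are the zeros of cos(nt) in (0, 2 pi). *)
Definition riesz_node (R : realType) (n k : nat) : R :=
  (k.*2.+1)%:R * pi / (n.*2)%:R.

(** With a = l pi / (2n), the sum times 2 sin a telescopes to sin(2 pi l) = 0, and sin a is nonzero
    as 0 < a < pi. *)
Lemma sum_cos_riesz_node (R : realType) (n l : nat) : (0 < l < n.*2)%N ->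
  \sum_(k < n.*2) cos (l%:R * riesz_node R n k) = 0.
Proof.
move=> /andP[l0 ln].
have n0 : (n.*2)%:R != 0 :> R by rewrite pnatr_eq0 -lt0n (leq_ltn_trans _ ln).
pose a : R := l%:R * pi / (n.*2)%:R.
have sa : 0 < sin a.
  apply: sin_gt0_pi; apply/andP; split.
    by rewrite divr_gt0 ?mulr_gt0 ?pi_gt0 ?ltr0n ?(leq_ltn_trans _ ln).
  rewrite ltr_pdivrMr ?ltr0n ?(leq_ltn_trans _ ln)//.
  by rewrite mulrC ltr_pM2l ?pi_gt0// ltr_nat.
have /(_ (n.*2)) := sum_cos_odd_multiples R _ a.
have -> : (n.*2.*2)%:R * a = l%:R * (pi *+ 2).
  by rewrite /a -(mul2n n.*2) natrM; field.
rewrite sin_nat2pi => /eqP; rewrite !mulf_eq0 pnatr_eq0/= (gt_eqF sa)/= => /eqP E.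
rewrite -[RHS]E; apply: eq_bigr => k _; congr cos.
by rewrite /a /riesz_node; field.
Qed.

Lemma riesz_node_mul (R : realType) (n k : nat) : (0 < n)%N ->
  n%:R * riesz_node R n k = k%:R * pi + pi / 2.
Proof.
move=> n0; have n0' : n%:R != 0 :> R by rewrite pnatr_eq0 -lt0n.
by rewrite /riesz_node -!mul2n -natr1 !natrM; field.
Qed.

Lemma cos_riesz_node_mul (R : realType) (n k : nat) : (0 < n)%N ->
  cos (n%:R * riesz_node R n k) = 0.
Proof. by move=> n0; rewrite riesz_node_mul// cosDpihalf sin_natpi oppr0. Qed.

Lemma sin_riesz_node_mul_sqr (R : realType) (n k : nat) : (0 < n)%N ->
  sin (n%:R * riesz_node R n k) ^+ 2 = 1.
Proof. by move=> n0; rewrite sin2cos2 cos_riesz_node_mul// expr0n subr0. Qed.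

(** * The Riesz weights and their sine and cosine moments *)

Lemma sin_half_riesz_node_gt0 (R : realType) (n k : nat) : (k < n.*2)%N ->
  0 < sin (riesz_node R n k / 2).
Proof.
move=> kn; have n0 : (0 < n.*2)%N by apply: leq_ltn_trans kn.
apply: sin_gt0_pi; rewrite /riesz_node; apply/andP; split.
  by rewrite !(divr_gt0, mulr_gt0) ?pi_gt0 ?ltr0n.
rewrite -mulrA -invfM -natrM ltr_pdivrMr ?ltr0n ?muln_gt0 ?n0//.
rewrite mulrC ltr_pM2l ?pi_gt0// ltr_nat; lia.
Qed.

(** Since sin(n t_k) = (-1)^k, this is Riesz's weight (-1)^k / (4n sin^2(t_k/2)); the sine form
    suits product-to-sum formulas. *)
Definition riesz_weight (R : realType) (n k : nat) : R :=
  sin (n%:R * riesz_node R n k) / (4 * n%:R * sin (riesz_node R n k / 2) ^+ 2).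

(** Product-to-sum leaves the frequencies n - m and n + m, both strictly between 0 and 2n. *)
Lemma sum_sin_riesz_node (R : realType) (n m : nat) : (0 < m < n)%N ->
  \sum_(k < n.*2) sin (n%:R * riesz_node R n k) * sin (m%:R * riesz_node R n k)
  = 0.
Proof.
move=> /andP[m0 mn].
transitivity (2^-1 * (\sum_(k < n.*2) cos ((n - m)%:R * riesz_node R n k)
    - \sum_(k < n.*2) cos ((n + m)%:R * riesz_node R n k))).
  rewrite -sumrB mulr_sumr; apply: eq_bigr => k _.
  rewrite (natrB _ (ltnW mn)) natrD mulrBl mulrDl cosB cosD.
  by field.
by rewrite !sum_cos_riesz_node ?subrr ?mulr0//; lia.
Qed.

(* The second difference in [m] of [sin (m t)] is [- 4 sin^2 (t/2) sin (m t)],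
   which cancels the denominator of the weight. *)
Lemma riesz_weight_sin_diff2 (R : realType) (n m : nat) :
  \sum_(k < n.*2) riesz_weight R n k * sin (m.+2%:R * riesz_node R n k)
  - 2 * \sum_(k < n.*2) riesz_weight R n k * sin (m.+1%:R * riesz_node R n k)
  + \sum_(k < n.*2) riesz_weight R n k * sin (m%:R * riesz_node R n k)
  = - (\sum_(k < n.*2)
      sin (n%:R * riesz_node R n k) * sin (m.+1%:R * riesz_node R n k)) / n%:R.
Proof.
rewrite mulr_sumr -sumrB -big_split mulNr mulr_suml -sumrN; apply: eq_bigr => k _.
have n0 : n%:R != 0 :> R by rewrite pnatr_eq0; have := ltn_ord k; lia.
have s0 := lt0r_neq0 (sin_half_riesz_node_gt0 R n k (ltn_ord k)).
rewrite /riesz_weight; set t := riesz_node R n k in s0 *.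
have E1 : m.+2%:R * t = m.+1%:R * t + t by rewrite -natr1 mulrDl mul1r.
have -> : m%:R * t = m.+1%:R * t - t by rewrite -[m.+1%:R]natr1 mulrDl mul1r addrK.
rewrite E1 !sinD sinN cosN /=.
have -> : cos t = 1 - 2 * sin (t / 2) ^+ 2.
  have -> : t = t / 2 *+ 2 by rewrite -mulr_natr; field.
  rewrite cos_mulr2n cos2sin2 -mulr_natr; set u := sin _.
  have -> : sin (t / 2 *+ 2 / 2) = u by congr sin; rewrite -mulr_natr; field.
  by ring.
by field; rewrite n0 s0.
Qed.

(** By orthogonality the second differences of [F] vanish at 1, ..., n - 1, so [F] is linear on 0,
    ..., n; the relation at n makes the slope 1. *)
Lemma riesz_weight_sin (R : realType) (n m : nat) : (0 < n)%N -> (m <= n)%N ->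
  \sum_(k < n.*2) riesz_weight R n k * sin (m%:R * riesz_node R n k) = m%:R.
Proof.
move=> n0.
pose F i : R := \sum_(k < n.*2) riesz_weight R n k * sin (i%:R * riesz_node R n k).
have n0' : n%:R != 0 :> R by rewrite pnatr_eq0 -lt0n.
have F0 : F 0 = 0 by apply: big1 => k _; rewrite mul0r sin0 mulr0.
have lin i : (i < n)%N -> F i.+1 - F i = F 1.
  elim: i => [|i IHi] ilt; first by rewrite F0 subr0.
  have := riesz_weight_sin_diff2 R n i; rewrite sum_sin_riesz_node ?ilt//.
  rewrite oppr0 mul0r -/(F _) -/(F _) -/(F _) => E.
  by rewrite -IHi; [lra | exact: ltnW].
(* The sum of the squares sin^2 (n t_k) is 2n, and F (n + 1) = F (n - 1) as cos (n t_k) = 0. *)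
have F1 : F 1 = 1.
  have := riesz_weight_sin_diff2 R n n.-1; rewrite (prednK n0).
  under [in X in _ = X]eq_bigr do rewrite -expr2 sin_riesz_node_mul_sqr//.
  rewrite sumr_const card_ord (_ : n.*2%:R = 2 * n%:R); last by rewrite -mul2n natrM.
  rewrite mulNr mulfK// -/(F _) -/(F _) -/(F _).
  have -> : F n.+1 = F n.-1.
    apply: eq_bigr => k _; congr (_ * _).
    have -> : n.-1%:R = n%:R - 1 :> R by rewrite -[X in X%:R - 1](prednK n0) -natr1 addrK.
    rewrite -natr1 mulrDl mulrBl mul1r sinD sinB cos_riesz_node_mul//.
    by rewrite mul0r addr0 subr0.
  have := lin n.-1; rewrite (prednK n0) => /(_ (ltnSn _)) <-; lra.
rewrite -/(F m); elim: m => [//|m IHm mn].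
by have := lin m mn; rewrite F1 (IHm (ltnW mn)) -natr1 => /eqP; rewrite subr_eq addrC => /eqP.
Qed.

Lemma riesz_node_rev (R : realType) (n : nat) (k : 'I_n.*2) :
  riesz_node R n (rev_ord k) = pi *+ 2 - riesz_node R n k.
Proof.
have n0 : n%:R != 0 :> R by rewrite pnatr_eq0; have := ltn_ord k; lia.
rewrite /riesz_node /= .
have -> : (n.*2 - k.+1).*2.+1 = (4 * n - k.*2.+1)%N by have := ltn_ord k; lia.
rewrite natrB; last by have := ltn_ord k; lia.
by rewrite (_ : n.*2%:R = 2 * n%:R); [field | rewrite -mul2n natrM].
Qed.

(** The reflection t -> 2 pi - t permutes the nodes, negates the weights and fixes the cosines, so
    the sum is its own negative. *)
Lemma riesz_weight_cos (R : realType) (n m : nat) :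
  \sum_(k < n.*2) riesz_weight R n k * cos (m%:R * riesz_node R n k) = 0.
Proof.
set S := LHS.
suff : S = - S by lra.
rewrite {1}/S (reindex_inj rev_ord_inj)/= -sumrN; apply: eq_bigr => k _.
rewrite /riesz_weight -!/(nat_of_ord (rev_ord k)) riesz_node_rev.
set t := riesz_node R n k.
have -> : m%:R * (pi *+ 2 - t) = - (m%:R * t) + m%:R * (pi *+ 2) by ring.
have -> : n%:R * (pi *+ 2 - t) = - (n%:R * t) + n%:R * (pi *+ 2) by ring.
have -> : (pi *+ 2 - t) / 2 = - (t / 2) + pi by field.
rewrite sinD cosD !sin_nat2pi !cos_nat2pi sinDpi !sinN !mulr1 !mulr0.
by rewrite addr0 subr0 opprK !mulNr cosN.
Qed.

(** As sin(n t_k) is 1 or -1, |w_k| = w_k sin(n t_k), and the sum is the sine moment of order n. *)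
Lemma sum_norm_riesz_weight (R : realType) (n : nat) : (0 < n)%N ->
  \sum_(k < n.*2) `|riesz_weight R n k| = n%:R.
Proof.
move=> n0; rewrite -(riesz_weight_sin R _ _ n0 (leqnn n)); apply: eq_bigr => k _.
have d0 : 0 <= 4 * n%:R * sin (riesz_node R n k / 2) ^+ 2 :> R.
  by rewrite mulr_ge0 ?sqr_ge0.
rewrite /riesz_weight normrM normfV (ger0_norm d0) [RHS]mulrAC -expr2.
have := sin_riesz_node_mul_sqr R n k n0; set s := sin _ => s1.
have /eqP := s1; rewrite sqrf_eq1 => /orP[]/eqP->;
  by rewrite ?sqrrN ?normrN normr1 expr1n.
Qed.

(** * M. Riesz's formula and Bernstein's inequality *)

Definition riesz_formula (R : realType) (n : nat) (f : R -> R) : Prop :=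
  forall x : R, is_derive x 1 f
    (\sum_(k < n.*2) riesz_weight R n k * f (x + riesz_node R n k)).

Lemma riesz_formula_comb (R : realType) (n : nat) (a b : R) (f g : R -> R) :
  riesz_formula R n f -> riesz_formula R n g ->
  riesz_formula R n (fun t => a * f t + b * g t).
Proof.
move=> Qf Qg x; have := is_deriveD (is_deriveZ a (Qf x)) (is_deriveZ b (Qg x)).
move=> D; apply: is_derive_eq.
rewrite !scaler_sumr -big_split; apply: eq_bigr => k _ /=.
by rewrite /GRing.scale/=; ring.
Qed.

(** The addition formula splits the sum into the two moments of order m, with values 0 and m,
    leaving the derivative -m sin(mx). *)
Lemma riesz_formula_cosM (R : realType) (n m : nat) : (0 < n)%N -> (m <= n)%N ->
  riesz_formula R n (fun t => cos (m%:R * t)).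
Proof.
move=> n0 mn x.
have D : is_derive x 1 (fun t : R => m%:R * t) m%:R.
  have := is_deriveZ m%:R (is_derive_id x (1 : R)).
  by rewrite /GRing.scale/= mulr1.
have := is_derive1_comp (is_derive_cos (m%:R * x)) D => Dc.
apply: is_derive_eq.
transitivity (cos (m%:R * x) *
    \sum_(k < n.*2) riesz_weight R n k * cos (m%:R * riesz_node R n k)
  - sin (m%:R * x) *
    \sum_(k < n.*2) riesz_weight R n k * sin (m%:R * riesz_node R n k)).
  rewrite riesz_weight_cos riesz_weight_sin//.
  by rewrite /GRing.scale/=; ring.
rewrite !mulr_sumr -sumrB; apply: eq_bigr => k _.
by rewrite mulrDr cosD; ring.
Qed.

(** The factor cos(mt) strengthens the induction on [i]: cos t cos((m+1)t) is half of cos((m+2)t) +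
    cos(mt), and the degree i + m stays at most n. *)
Lemma riesz_formula_cosX_cosM (R : realType) (n i m : nat) :
  (0 < n)%N -> (i + m <= n)%N ->
  riesz_formula R n (fun t => cos t ^+ i * cos (m%:R * t)).
Proof.
move=> n0; elim: i m => [|i IHi] [|m] imn.
- by under eq_fun do rewrite expr0 mul1r; exact: riesz_formula_cosM.
- by under eq_fun do rewrite expr0 mul1r; exact: riesz_formula_cosM.
- have := IHi 1%N ltac:(lia).
  congr riesz_formula; apply/funext => t.
  by rewrite mul1r mul0r cos0 mulr1 exprSr.
- have := riesz_formula_comb R n 2^-1 2^-1 _ _ (IHi m.+2 ltac:(lia)) (IHi m ltac:(lia)).
  congr riesz_formula; apply/funext => t.
  have E : m.+1%:R * t = m%:R * t + t by rewrite -natr1 mulrDl mul1r.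
  have -> : m.+2%:R * t = m.+1%:R * t + t by rewrite -[in LHS]natr1 mulrDl mul1r.
  have -> : m%:R * t = m.+1%:R * t - t by rewrite E addrK.
  by rewrite !cosD cosN sinN exprS; field.
Qed.

Lemma riesz_formula_horner_cos (R : realType) (n : nat) (p : {poly R}) :
  (0 < n)%N -> (size p <= n.+1)%N -> riesz_formula R n (fun t => p.[cos t]).
Proof.
move=> n0 pn.
have mono i : (i <= n)%N -> riesz_formula R n (fun t => cos t ^+ i).
  move=> in_; have := riesz_formula_cosX_cosM R n i 0 n0.
  rewrite addn0 => /(_ in_); congr riesz_formula; apply/funext => t.
  by rewrite mul0r cos0 mulr1.
suff H N : (N <= n.+1)%N ->
    riesz_formula R n (fun t => \sum_(i < N) p`_i * cos t ^+ i).
  by under eq_fun do rewrite horner_coef; exact: H.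
elim: N => [_|N IHN Nn].
  (* The empty sum is the zero function, taken as a combination with zero coefficients. *)
  have := riesz_formula_comb R n 0 0 _ _ (mono 0 (leq0n _)) (mono 0 (leq0n _)).
  by congr riesz_formula; apply/funext => t; rewrite big_ord0 !mul0r addr0.
have := riesz_formula_comb R n 1 p`_N _ _ (IHN (ltnW Nn)) (mono N Nn).
by congr riesz_formula; apply/funext => t; rewrite big_ord_recr/= mul1r.
Qed.

(** Mean value theorem: by Riesz's formula the derivative of p(cos t) is at most M sum_k |w_k| = n M
    in modulus. *)
Lemma bernstein_lipschitz (R : realType) (n : nat) (p : {poly R}) (M : R) :
  (0 < n)%N -> (size p <= n.+1)%N ->
  (forall t, `|p.[cos t]| <= M) ->
  forall a b, `|p.[cos b] - p.[cos a]| <= n%:R * M * `|b - a|.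
Proof.
move=> n0 pn pM.
have D := riesz_formula_horner_cos R n p n0 pn.
suff H a b : a <= b -> `|p.[cos b] - p.[cos a]| <= n%:R * M * `|b - a|.
  by move=> a b; case/orP: (le_total a b) => /H//; rewrite distrC (distrC a).
move=> ab.
have cont : continuous (fun t => p.[cos t]).
  move=> x; have := D x => -[dx _]; exact/differentiable_continuous/derivable1_diffP.
have [c _ ->] := MVT_segment ab (fun x _ => D x) (continuous_subspaceT cont).
rewrite normrM ler_wpM2r// -sum_norm_riesz_weight// mulr_suml.
apply: (le_trans (ler_norm_sum _ _ _)); apply: ler_sum => k _.
by rewrite normrM ler_wpM2l.
Qed.

(** * Lagrange interpolation at distinct nodes, and the Chebyshev-Lobatto nodes *)

Lemma lagrange_basis_node (R : realType) (n : nat) (x : 'I_n.+1 -> R) i j :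
  injective x -> (lagrange_basis x j).[x i] = (i == j)%:R.
Proof.
move=> xinj; rewrite lagrange_basisE; case: eqVneq => [->|ij].
  by apply: big1 => k kj; rewrite divff// subr_eq0 (inj_eq xinj) eq_sym.
by rewrite (bigD1 i)//= subrr !mul0r.
Qed.

Lemma size_lagrange_basis (R : realType) (n : nat) (x : 'I_n.+1 -> R) j :
  (size (lagrange_basis x j) <= n.+1)%N.
Proof.
rewrite /lagrange_basis.
under eq_bigr do rewrite -mul_polyC.
rewrite big_split /= -rmorph_prod mul_polyC.
apply: (leq_trans (size_scale_leq _ _)).
rewrite -big_filter size_prod_XsubC ltnS size_filter.
(* The product runs over the n indices other than [j]. *)
have := count_predC (pred1 j) (index_enum 'I_n.+1).
rewrite (_ : size _ = n.+1); last by rewrite -[RHS]card_ord cardE /enum_mem filter_predT.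
have -> : count (pred1 j) (index_enum 'I_n.+1) = 1%N.
  by rewrite count_uniq_mem ?index_enum_uniq// mem_index_enum.
by rewrite add1n => -[E]; rewrite (eq_count (a2 := predC (pred1 j))) ?E.
Qed.

(** The difference of both sides has size at most n + 1 and vanishes at n + 1 distinct nodes. *)
Lemma lagrange_interpolation (R : realType) (n : nat) (x : 'I_n.+1 -> R)
    (p : {poly R}) : injective x -> (size p <= n.+1)%N ->
  p = \sum_(j < n.+1) p.[x j] *: lagrange_basis x j.
Proof.
move=> xinj pn; apply/eqP; rewrite -subr_eq0; apply/eqP.
apply: (@roots_geq_poly_eq0 _ _ [seq x i | i : 'I_n.+1]).
- apply/allP => _ /mapP[i _ ->]; rewrite rootE hornerD hornerN horner_sum.
  rewrite (bigD1 i)//= hornerZ lagrange_basis_node// eqxx mulr1.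
  rewrite big1 ?addr0 ?subrr// => k ki.
  by rewrite hornerZ lagrange_basis_node// eq_sym (negbTE ki) mulr0.
- by rewrite map_inj_uniq// enum_uniq.
- rewrite size_map -cardE card_ord.
  apply: (leq_trans (size_polyD _ _)); rewrite size_polyN geq_max pn/=.
  apply: (leq_trans (size_sum _ _ _)); apply/bigmax_leqP => j _.
  exact: (leq_trans (size_scale_leq _ _) (size_lagrange_basis R n x j)).
Qed.

(** The cosine is injective on [0, pi], which contains all Lobatto angles. *)
Lemma injective_lobatto_point (R : realType) (n : nat) : (0 < n)%N ->
  injective (@lobatto_point R n).
Proof.
move=> n0 i j /cos_inj.
have n0' : 0 < n%:R :> R by rewrite ltr0n.
have ang k : @lobatto_angle R n k \in `[0, pi].
  rewrite in_itv/= /lobatto_angle; apply/andP; split.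
    by rewrite divr_ge0 ?mulr_ge0 ?pi_ge0.
  by rewrite ler_pdivrMr// mulrC ler_pM2l ?pi_gt0// ler_nat -ltnS.
move=> /(_ (ang i) (ang j)) /(congr1 (fun t => t * n%:R / pi)).
rewrite /lobatto_angle !divfK ?gt_eqF// !mulfK ?gt_eqF ?pi_gt0//.
by move=> /eqP; rewrite eqr_nat => /eqP/val_inj.
Qed.

(** * The perturbation bound *)

Theorem theorem3p1 (R : realType) (n : nat) (n_ge1 : (1 <= n)%N)
    (eps : 'I_n.+1 -> R) (eps_first : eps ord0 = 0) (eps_last : eps ord_max = 0)
    (x : 'I_n.+1 -> R)
    (xE : forall j : 'I_n.+1, x j = cos (lobatto_angle R j + eps j))
    (x_distinct : injective x)
    (sigma : R) (sigma_gt0 : 0 < sigma)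
    (eps_le : \big[Num.max/0]_(j < n.+1) `|eps j| <= sigma)
    (small : n%:R * sigma * lebesgue_constant (@lobatto_point R n) < 1) :
  lebesgue_constant x <=
    lebesgue_constant (@lobatto_point R n) /
      (1 - n%:R * sigma * lebesgue_constant (@lobatto_point R n)).
Proof.
have [[c c11 Lc] Lx] := lebesgue_constant_max x.
have [_ L0] := lebesgue_constant_max (@lobatto_point R n).
set L := lebesgue_constant x in Lc Lx *.
set M := lebesgue_constant _ in small L0 *.
rewrite ler_pdivlMr ?subr_gt0//.
(* These signs turn the sum at [c] into the Lebesgue function, so [p] takes the value [L] there; a
   sign may be 0, hence only |s_j| <= 1. *)
pose s j := Num.sg (lagrange_basis x j).[c].
have s1 j : `|s j| <= 1 by rewrite normr_sg lern1 leq_b1.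
pose p := \sum_(j < n.+1) s j *: lagrange_basis x j.
have pE t : p.[t] = \sum_(j < n.+1) s j * (lagrange_basis x j).[t].
  by rewrite horner_sum; apply: eq_bigr => j _; rewrite hornerZ.
have pc : p.[c] = L.
  by rewrite pE -Lc; apply: eq_bigr => j _; rewrite -normrEsg.
have px j : p.[x j] = s j.
  rewrite pE (bigD1 j)//= lagrange_basis_node// eqxx mulr1 big1 ?addr0// => k kj.
  by rewrite lagrange_basis_node// eq_sym (negbTE kj) mulr0.
have psize : (size p <= n.+1)%N.
  apply: (leq_trans (size_sum _ _ _)); apply/bigmax_leqP => j _.
  exact: (leq_trans (size_scale_leq _ _) (size_lagrange_basis R n x j)).
have pL t : `|p.[cos t]| <= L.
  apply: le_trans (Lx (cos t) _); last by rewrite in_itv/= cos_geN1 cos_le1.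
  rewrite pE; apply: (le_trans (ler_norm_sum _ _ _)); apply: ler_sum => j _.
  by rewrite normrM ler_piMl.
have L_ge0 : 0 <= L := le_trans (normr_ge0 _) (pL 0).
(* The angles of [x j] and of the Lobatto point differ by [eps j], so [p] moves by at most n sigma L
   from its value [s j] at [x j]. *)
have p0 (j : 'I_n.+1) : `|p.[lobatto_point R j]| <= 1 + n%:R * sigma * L.
  rewrite -[p.[_]](subrK p.[x j]) addrC px; apply: (le_trans (ler_normD _ _)).
  apply: lerD => //; rewrite -px xE.
  apply: (le_trans (bernstein_lipschitz R n p L n_ge1 psize pL _ _)).
  rewrite opprD addrA subrr add0r normrN mulrAC ler_wpM2r//.
  by rewrite ler_wpM2l// (le_trans _ eps_le)// (le_bigmax _ (fun j => `|eps j|)).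
(* The goal L (1 - n sigma M) <= M is this bound with the terms in [L] collected. *)
suff : L <= (1 + n%:R * sigma * L) * M by lra.
rewrite -{1}pc (lagrange_interpolation R n _ p (injective_lobatto_point R n n_ge1) psize).
rewrite horner_sum; apply: (le_trans (ler_norm _)).
apply: (le_trans (ler_norm_sum _ _ _)).
(* The common bound on the nodal values factors out, leaving the Lobatto Lebesgue function at [c],
   at most [M]. *)
apply: (@le_trans _ _ ((1 + n%:R * sigma * L) * lebesgue_function (@lobatto_point R n) c)).
  rewrite mulr_sumr; apply: ler_sum => j _.
  by rewrite hornerZ normrM ler_wpM2r.
by rewrite ler_wpM2l ?L0// addr_ge0 ?mulr_ge0// ltW.
Qed.
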